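(* For $\sigma_n\in\rho(\Omega_n)$ let $z_n=\sigma_n^{-1}(1)/n$. Then, for all $n$ large enough, $$\sup_{\sigma_n\in\rho(\Omega_n)}d_\square(\mu_{\sigma_n},\mu^{z_n})<400\,n^{-0.4}.$$
   Context: Permutons. A permuton is a Borel probability measure on $[0,1]^2$ with uniform marginals. For a permutation $\sigma$ of size $n$, the permuton $\mu_\sigma$ is the measure equal to $n$ times Lebesgue measure on each of the squares $[(i-1)/n,i/n]\times[(\sigma(i)-1)/n,\sigma(i)/n]$, $i=1,\dots,n$, and zero elsewhere. For permutons $\mu,\mu'$, $d_\square(\mu,\mu')=\sup_{R}|\mu(R)-\mu'(R)|$, the supremum being over (axis-parallel) rectangles $R$ contained in $[0,1]^2$. The permuton $\mu^z$. For $z\in[0,1]$ let $L_1,L_2,L_3,L_4$ be the segments from $(0,z)$ to $(z,0)$, from $(0,z)$ to $(1-z,1)$, from $(z,0)$ to $(1,1-z)$, from $(1-z,1)$ to $(1,1-z)$, respectively. For Borel $S\subseteq[0,1]^2$ put $\mu^z(S)=\sum_{i=1}^4\frac12\nu(\pi_x(S\cap L_i))$, where $\nu$ is Lebesgue measure on $[0,1]$ and $\pi_x$ the projection on the $x$-axis. Counting functions. For $X\in\{U,D\}^n$ and a label $A\in\{U,D\}$, $ct_A(i)$ is the number of $A$'s among $X_1,\dots,X_i$ ($ct_A(0)=0$), and $pos_A(i)$ is the index of the $i$-th $A$ in $X$, with $pos_A(0)=0$ and $pos_A(i)=n$ if $i>ct_A(n)$. The functions $ct_L,ct_R,pos_L,pos_R$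 are defined in the same way from $Y\in\{L,R\}^n$. Petrov conditions. A label $A$ satisfies the Petrov conditions if: (1) $|ct_A(i)-ct_A(j)-\frac12(i-j)|<n^{0.4}$ for all $0\le i,j\le n$ with $|i-j|<n^{0.6}$; (2) $|ct_A(i)-ct_A(j)-\frac12(i-j)|<\frac12|i-j|^{0.6}$ for all $0\le i,j\le n$ with $|i-j|>n^{0.3}$; (3) $|pos_A(i)-pos_A(j)-2(i-j)|<n^{0.4}$ for all $0\le i,j\le ct_A(n)$ with $|i-j|<n^{0.6}$; (4) $|pos_A(i)-pos_A(j)-2(i-j)|<2|i-j|^{0.6}$ for all $0\le i,j\le ct_A(n)$ with $|i-j|>n^{0.3}$. The sequence $X$ (resp. $Y$) satisfies the Petrov conditions if both its labels do. $\Omega_n$ is the set of triples $(X,Y,z_0)\in\{U,D\}^n\times\{L,R\}^n\times[n]$ with $X_1=X_n=X_{z_0}=D$, $Y_1=Y_n=L$, such that $X$ and $Y$ satisfy the Petrov conditions and $n^{0.9}\le z_0\le n-n^{0.9}$. The map $\rho$. For $(X,Y,z_0)\in\Omega_n$ let $z_2=pos_U(ct_L(n)-ct_D(z_0))$ and $\Lambda_1=\{(pos_D(i),pos_L(ct_D(z_0)+1-i)):1\le i\le ct_D(z_0)\}$, $\Lambda_2=\{(pos_U(i),pos_L(ct_D(z_0)+i)):1\le i\le ct_U(z_2)\}$, $\Lambda_3=\{(pos_D(i),pos_R(i-ct_D(z_0))):ct_D(z_0)+1\le i\le ct_D(n)\}$, $\Lambda_4=\{(pos_U(i),pos_R(n-ct_D(z_0)+1-i)):ct_U(z_2)+1\le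 i\le ct_U(n)\}$. For $n$ large enough, $\Lambda_1\cup\Lambda_2\cup\Lambda_3\cup\Lambda_4$ is the diagram $\{(i,\sigma(i)):i\in[n]\}$ of a permutation $\sigma$ of $[n]$, and $\rho(X,Y,z_0)$ denotes this permutation (for $n$ large it is a square permutation with $\sigma^{-1}(1)=z_0$). *)

(* Defs.v *)
From HB Require Import structures.
From mathcomp Require Import all_boot all_order all_algebra all_fingroup.
From mathcomp Require Import all_classical all_reals all_analysis.

Set Implicit Arguments.
Unset Strict Implicit.
Unset Printing Implicit Defensive.

Import Order.TTheory GRing.Theory Num.Theory.
Import numFieldNormedType.Exports.

Local Open Scope classical_set_scope.
Local Open Scope ring_scope.

(** Positions and values are numbered from 1, as natural numbers; the ordinal
    [i : 'I_n] stands for the element [i.+1] of {1, ..., n}. *)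

Section Permutons.
Variable R : realType.

Definition lebesgue2 : set (R * R) -> \bar R :=
  (@lebesgue_measure R \x @lebesgue_measure R)%E.

Definition perm_cell (n : nat) (s : 'S_n) (i : 'I_n) : set (R * R) :=
  `[i%:R / n%:R, i.+1%:R / n%:R] `*` `[(s i)%:R / n%:R, (s i).+1%:R / n%:R].

Definition mu_perm (n : nat) (s : 'S_n) (S : set (R * R)) : \bar R :=
  (\sum_(i < n) n%:R%:E * lebesgue2 (S `&` perm_cell s i))%E.

Definition segment (a b : R * R) : set (R * R) :=
  [set ((1 - t) * a.1 + t * b.1, (1 - t) * a.2 + t * b.2) | t in `[0, 1]].

Definition mu_z (z : R) (S : set (R * R)) : \bar R :=
  let half_proj L := (2^-1%:E * lebesgue_measure (fst @` (S `&` L)))%E in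
  (half_proj (segment (0%R, z) (z, 0%R)) +
   half_proj (segment (0%R, z) ((1 - z)%R, 1%R)) +
   half_proj (segment (z, 0%R) (1%R, (1 - z)%R)) +
   half_proj (segment ((1 - z)%R, 1%R) (1%R, (1 - z)%R)))%E.

(** Closed rectangles: for permutons the inclusion of sides is immaterial, as
    uniform marginals do not charge lines. *)
Definition unit_rectangles : set (set (R * R)) :=
  [set Q | exists a b c d : R,
     [/\ 0 <= a <= b, b <= 1, 0 <= c <= d, d <= 1 &
         Q = `[a, b] `*` `[c, d]]].

Definition d_square (mu mu' : set (R * R) -> \bar R) : \bar R :=
  ereal_sup [set `|mu Q - mu' Q|%E | Q in unit_rectangles].

End Permutons.

(** The element sigma^-1(1) of {1, ..., n}; junk value 0 when n = 0. *)
Definition inv_one (n : nat) : 'S_n -> nat :=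
  if n is m.+1 then fun s : 'S_m.+1 => (s^-1%g ord0).+1 else fun=> 0%N.

Inductive ud := Up | Down.
Inductive lr := Left | Right.

Definition ud_bool (a : ud) : bool := if a is Up then true else false.
Definition bool_ud (b : bool) : ud := if b then Up else Down.
Lemma ud_boolK : cancel ud_bool bool_ud. Proof. by case. Qed.
HB.instance Definition _ := Equality.copy ud (can_type ud_boolK).

Definition lr_bool (a : lr) : bool := if a is Left then true else false.
Definition bool_lr (b : bool) : lr := if b then Left else Right.
Lemma lr_boolK : cancel lr_bool bool_lr. Proof. by case. Qed.
HB.instance Definition _ := Equality.copy lr (can_type lr_boolK).

Section Counting.
Variables (T : eqType) (n : nat) (X : n.-tuple T) (A : T).

Definition ct (i : nat) : nat := count_mem A (take i X).

(** Increasing list of the j in {1, ..., n} with X_j = A; the default value of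
    [nth] is never reached. *)
Definition positions : seq nat := [seq j <- iota 1 n | nth A X j.-1 == A].

(** Prepending 0 gives [pos 0 = 0]; the default n covers [i > ct n]. *)
Definition pos (i : nat) : nat := nth n (0%N :: positions) i.

End Counting.

Definition petrov_label (R : realType) (T : eqType) (n : nat)
    (X : n.-tuple T) (A : T) : Prop :=
  let c i : R := (ct X A i)%:R in
  let p i : R := (pos X A i)%:R in
  let N : R := n%:R in
  let dist (i j : nat) : R := `|i%:R - j%:R| in
  [/\ forall i j : nat, (i <= n)%N -> (j <= n)%N -> dist i j < N `^ (6 / 10) ->
        `|c i - c j - 2^-1 * (i%:R - j%:R)| < N `^ (4 / 10),
      forall i j : nat, (i <= n)%N -> (j <= n)%N -> N `^ (3 / 10) < dist i j ->
        `|c i - c j - 2^-1 * (i%:R - j%:R)| < 2^-1 * dist i j `^ (6 / 10),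
      forall i j : nat, (i <= ct X A n)%N -> (j <= ct X A n)%N ->
        dist i j < N `^ (6 / 10) ->
        `|p i - p j - 2 * (i%:R - j%:R)| < N `^ (4 / 10)
    & forall i j : nat, (i <= ct X A n)%N -> (j <= ct X A n)%N ->
        N `^ (3 / 10) < dist i j ->
        `|p i - p j - 2 * (i%:R - j%:R)| < 2 * dist i j `^ (6 / 10)].

Definition petrov (R : realType) (T : eqType) (n : nat) (X : n.-tuple T) :=
  forall A : T, petrov_label R X A.

Definition triple (n : nat) : Type := (n.-tuple ud * n.-tuple lr * nat)%type.

(** The defaults [Up] and [Right] of [nth] make the letter conditions fail
    outside of {1, ..., n}. *)
Definition Omega (R : realType) (n : nat) : set (triple n) :=
  [set w : triple n | let: (X, Y, z0) := w in
    [/\ (1 <= z0 <= n)%N,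
        [/\ nth Up X 0 = Down, nth Up X n.-1 = Down & nth Up X z0.-1 = Down],
        nth Right Y 0 = Left /\ nth Right Y n.-1 = Left,
        petrov R X /\ petrov R Y
      & (n%:R : R) `^ (9 / 10) <= z0%:R <= n%:R - (n%:R : R) `^ (9 / 10)]].

Arguments Omega R n : clear implicits.

Section Rho.
Variable n : nat.

Definition Lambda (w : triple n) : set (nat * nat) :=
  let: (X, Y, z0) := w in
  let ctU := ct X Up in let ctD := ct X Down in let ctL := ct Y Left in
  let posU := pos X Up in let posD := pos X Down in
  let posL := pos Y Left in let posR := pos Y Right in
  let z2 := posU (ctL n - ctD z0)%N in
  [set (posD i, posL (ctD z0 + 1 - i)%N) | i in
     [set i | (1 <= i <= ctD z0)%N]] `|`
  [set (posU i, posL (ctD z0 + i)%N) | i in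
     [set i | (1 <= i <= ctU z2)%N]] `|`
  [set (posD i, posR (i - ctD z0)%N) | i in
     [set i | (ctD z0 + 1 <= i <= ctD n)%N]] `|`
  [set (posU i, posR (n - ctD z0 + 1 - i)%N) | i in
     [set i | (ctU z2 + 1 <= i <= ctU n)%N]].

Definition diagram (s : 'S_n) : set (nat * nat) :=
  [set (i.+1, (s i).+1) | i in [set: 'I_n]].

(** The permutation with diagram [Lambda w]; [xget] returns the identity as a
    junk value if there is none. *)
Definition rho (w : triple n) : 'S_n :=
  xget 1%g [set s : 'S_n | diagram s = Lambda w].

End Rho.

(* Main.v *)
Require Import Defs.
From mathcomp Require Import all_boot all_order all_algebra all_fingroup.
From mathcomp Require Import all_classical all_reals all_analysis.
From mathcomp Require Import zify ring lra.

(** Each of the four families making up [Lambda] is a sequence of points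
    [(x_i, y_i)], [lo < i <= hi], and with [e = n^0.6] the Petrov conditions
    give [x_i = 2i + O(e)] and [y_i = n w + 2i + O(e)] or
    [y_i = n w - 2i + O(e)], while [2 lo] and [2 hi] are within [O(e)] of [n]
    times the abscissas of the endpoints of the matching segment of [mu_z].
    Hence, up to [O(e)], the number of cells of the family meeting (resp.
    contained in) a rectangle [Q] is the number of integers [i] with [2i] in the
    interval [n pi_x(Q `&` L)], which is half the length of that interval.
    Dividing by [n] gives an error [8 e / n] per family and [32 n^-0.4] in
    total. *)

Set Implicit Arguments.
Unset Strict Implicit.
Unset Printing Implicit Defensive.

Import Order.TTheory GRing.Theory Num.Theory.

Local Open Scope classical_set_scope.

(** * Counting letters of a word and locating them *)

Section Positions.
Variables (T : eqType) (n : nat) (X : n.-tuple T) (A : T).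

Lemma count_mem_take_iota i : (i <= n)%N ->
  count (fun j => nth A X j.-1 == A) (iota 1 i) = ct X A i.
Proof.
move=> le_in; rewrite /ct -[take i X](@mkseq_nth _ A).
rewrite size_takel ?size_tuple // /mkseq count_map -[1%N]addn0 iotaDl count_map.
apply: eq_in_count => j; rewrite mem_iota add0n => /andP[_ lt_ji] /=.
by rewrite nth_take.
Qed.

Lemma size_positions : size (positions X A) = ct X A n.
Proof. by rewrite size_filter count_mem_take_iota. Qed.

Lemma ct_leq i : (ct X A i <= ct X A n)%N.
Proof.
rewrite /ct [take n X]take_oversize ?size_tuple //.
by rewrite -[X in (_ <= count_mem A X)%N](cat_take_drop i) count_cat leq_addr.
Qed.

Lemma ct_max : (ct X A n <= n)%N.
Proof.
by rewrite -size_positions size_filter (leq_trans (count_size _ _)) ?size_iota.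
Qed.

Lemma pos_ct j : (0 < j <= n)%N -> nth A X j.-1 = A -> pos X A (ct X A j) = j.
Proof.
case: j => // j /= lt_jn XjA.
have ctS : ct X A j.+1 = (ct X A j).+1.
  rewrite -!count_mem_take_iota ?(ltnW lt_jn) //.
  have -> : iota 1 j.+1 = iota 1 j ++ [:: j.+1].
    by rewrite -{1}[j.+1]addn1 iotaD add1n.
  by rewrite count_cat /= XjA eqxx addn1.
rewrite /pos ctS /= /positions.
(* The filtered prefix has [ct X A j] entries, so this index falls on the head [j.+1] of the
   remaining list. *)
have -> : iota 1 n = iota 1 j ++ j.+1 :: iota j.+2 (n - j.+1).
  by rewrite -{1}(subnKC lt_jn) addSnnS iotaD add1n.
rewrite filter_cat nth_cat size_filter count_mem_take_iota ?(ltnW lt_jn) //.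
by rewrite ltnn subnn /= XjA eqxx.
Qed.

Lemma map_pos_iota : [seq pos X A i | i <- iota 1 (ct X A n)] = positions X A.
Proof.
rewrite -[RHS](@mkseq_nth _ n) size_positions /mkseq.
by rewrite -[1%N]addn0 iotaDl -map_comp; apply: eq_map.
Qed.

(** By [pos_ct], [k] and [ct X A (pos X A k)] have the same image under [pos], which is injective on
    nonzero indices because [positions] has no duplicates. *)
Lemma ct_pos k : (k <= ct X A n)%N -> ct X A (pos X A k) = k.
Proof.
case: k => [|k] lt_k; first by rewrite /pos /= /ct take0.
have: pos X A k.+1 \in positions X A.
  by rewrite /pos /= mem_nth ?size_positions.
rewrite mem_filter mem_iota add1n ltnS => /andP[/eqP XA lejn].
have posK := pos_ct lejn XA.
(* A zero count is excluded first: index 0 reads the prepended 0 and not an entry of [positions]. *)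
have ct0 : (0 < ct X A (pos X A k.+1))%N.
  case: (posnP (ct X A (pos X A k.+1))) => // ct0.
  by move: posK lejn; rewrite ct0 {1}/pos /= => <-.
have u : uniq (positions X A) by rewrite filter_uniq ?iota_uniq.
have := ct_leq (pos X A k.+1); move: ct0 posK.
case: (ct X A _) => // m _ + lt_m; rewrite /pos /= => /eqP.
by rewrite nth_uniq ?size_positions // => /eqP->.
Qed.

Lemma pos_first : (0 < n)%N -> nth A X 0 = A -> pos X A 1 = 1%N.
Proof.
move=> n_gt0 X0.
have := @pos_ct 1 n_gt0 X0.
rewrite -count_mem_take_iota //= X0 eqxx addn0 //.
Qed.

End Positions.

Section TwoLetters.
Variables (T : eqType) (n : nat) (X : n.-tuple T) (A B : T).
Hypotheses (neqAB : A != B) (AB : forall x, (x == B) = (x != A)).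

Lemma perm_positions : perm_eq (positions X A ++ positions X B) (iota 1 n).
Proof.
have /permPr <- := permEl (perm_filterC (fun j => nth A X j.-1 == A) (iota 1 n)).
rewrite perm_cat2l.
suff <- : [seq j <- iota 1 n | nth B X j.-1 == B] =
  [seq j <- iota 1 n | predC (fun j => nth A X j.-1 == A) j] by [].
apply: eq_in_filter => j; rewrite mem_iota add1n ltnS => /andP[j0 jn] /=.
(* The two filters read [X] with different [nth] defaults, which agree for [j] in {1, ..., n}. *)
by rewrite AB (set_nth_default A) // size_tuple prednK.
Qed.

Lemma ctD : (ct X A n + ct X B n)%N = n.
Proof.
by rewrite -!size_positions -size_cat (perm_size perm_positions) size_iota.
Qed.

End TwoLetters.

(** * Permutations given by a list of points *)

Lemma diagram_exists (n : nat) (pts : seq (nat * nat)) :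
    perm_eq (unzip1 pts) (iota 1 n) -> perm_eq (unzip2 pts) (iota 1 n) ->
  exists s : 'S_n, diagram s = [set` pts].
Proof.
move=> p1 p2.
have sz : size pts = n by rewrite -(size_map fst) (perm_size p1) size_iota.
have u1 : uniq (unzip1 pts) by rewrite (perm_uniq p1) iota_uniq.
have u2 : uniq (unzip2 pts) by rewrite (perm_uniq p2) iota_uniq.
(* The ordinate of the point with abscissa [i]. Injectivity comes from the absence of repetitions in
   both coordinate lists. *)
pose f (i : nat) := nth 0%N (unzip2 pts) (index i (unzip1 pts)).
have in1 (i : 'I_n) : i.+1 \in unzip1 pts.
  by rewrite (perm_mem p1) mem_iota add1n /= ltnS ltn_ord.
have lt_idx (i : 'I_n) : (index i.+1 (unzip1 pts) < size pts)%N.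
  by have := in1 i; rewrite -index_mem size_map.
have f_in (i : 'I_n) : (0 < f i.+1 <= n)%N.
  have : f i.+1 \in unzip2 pts by rewrite mem_nth // size_map.
  by rewrite (perm_mem p2) mem_iota add1n ltnS.
have lt_f (i : 'I_n) : ((f i.+1).-1 < n)%N.
  by have /andP[? ?] := f_in i; rewrite prednK.
have inj : injective (fun i => Ordinal (lt_f i)).
  move=> i j /(congr1 val) /= /(congr1 succn).
  have /andP[? _] := f_in i; have /andP[? _] := f_in j.
  rewrite !prednK // => /eqP; rewrite nth_uniq ?size_map // => /eqP.
  by move/(congr1 (nth 0%N (unzip1 pts))); rewrite !nth_index // => -[] /val_inj.
exists (perm inj); apply/seteqP; split=> [_ [i _ <-]|[x y] /= xy].
  rewrite permE /= prednK; last by case/andP: (f_in i).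
  apply/(nthP (0%N, 0%N)); exists (index i.+1 (unzip1 pts)) => //.
  rewrite [LHS]surjective_pairing -(nth_map _ 0%N fst) // -(nth_map _ 0%N snd) //.
  by rewrite nth_index.
have : x \in iota 1 n by rewrite -(perm_mem p1) (map_f fst xy).
rewrite mem_iota add1n ltnS => /andP[x0 xn].
have xn' : (x.-1 < n)%N by rewrite prednK.
exists (Ordinal xn') => //; rewrite permE /= !prednK //; last first.
  by have /= := f_in (Ordinal xn'); rewrite prednK // => /andP[].
congr pair; rewrite /f.
have /(nthP (0%N, 0%N))[k kn kE] := xy.
have -> : x = nth 0%N (unzip1 pts) k by rewrite (nth_map (0%N, 0%N)) ?kE.
by rewrite index_uniq ?size_map // (nth_map (0%N, 0%N)) ?kE.
Qed.

Lemma big_diagram (V : nmodType) (n : nat) (s : 'S_n) (pts : seq (nat * nat))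
    (F : nat -> nat -> V) :
  uniq pts -> diagram s = [set` pts] ->
  (\sum_(i < n) F i.+1 (s i).+1 = \sum_(p <- pts) F p.1 p.2)%R.
Proof.
move=> u sE.
rewrite -(big_map (fun i : 'I_n => (i.+1, (s i).+1)) xpredT (fun p => F p.1 p.2)).
apply: perm_big; apply: uniq_perm => //.
  by rewrite map_inj_uniq ?index_enum_uniq // => i j [] /val_inj.
move=> p; apply/mapP/idP => [[i _ ->]|pp].
  by have : [set` pts] (i.+1, (s i).+1) by rewrite -sE; exists i.
have : diagram s p by rewrite sE.
by case=> i _ <-; exists i => //; rewrite mem_index_enum.
Qed.

Local Open Scope ring_scope.

(** * Weighted counting of the integers in a real interval *)

Section Counting.
Variable R : realType.

Lemma sum_weights_le (w : nat -> R) (lo hi : nat) (u v : R) :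
    (lo <= hi)%N -> (forall i, 0 <= w i <= 1) ->
    (forall i, (lo < i <= hi)%N -> w i != 0 -> u <= i%:R <= v) ->
  \sum_(lo.+1 <= i < hi.+1) w i <= Num.max 0 (v - u + 1).
Proof.
move=> le_lohi w01 wuv.
(* Capping [v] at [hi] makes the bound suitable for induction: a nonzero new weight raises the cap
   by exactly 1, which pays for that weight. *)
suff : \sum_(lo.+1 <= i < hi.+1) w i <= Num.max 0 (Num.min v hi%:R - u + 1).
  have mv : Num.min v hi%:R <= v by rewrite ge_min lexx.
  move=> h; apply: le_trans h _; rewrite ge_max le_max lexx /= le_max.
  by apply/orP; right; lra.
elim: hi le_lohi wuv => [|h IH].
  by rewrite leqn0 => /eqP-> _; rewrite big_geq // le_max lexx.
rewrite leq_eqVlt => /predU1P[<- _|lt_loh wuv].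
  by rewrite big_geq // le_max lexx.
rewrite big_nat_recr //=.
have {}IH : \sum_(lo.+1 <= i < h.+1) w i <= Num.max 0 (Num.min v h%:R - u + 1).
  by apply: IH => // i /andP[loi le_ih]; apply: wuv; rewrite loi (leq_trans le_ih).
have [w0|wn0] := eqVneq (w h.+1) 0.
  rewrite w0 addr0 (le_trans IH) // ge_max !le_max lexx /= lerD2r lerD2r.
  by apply/orP; right; rewrite le_min !ge_min lexx /= ler_nat leqnSn orbT.
have := wuv h.+1; rewrite lt_loh leqnn => /(_ isT wn0) /andP[uh hv].
have /andP[_ w1] := w01 h.+1.
have hS : (h.+1%:R : R) = h%:R + 1 by rewrite -natr1.
rewrite le_max; apply/orP; right.
move: IH; rewrite (min_idPr hv) (_ : Num.min v h%:R = h%:R); last first.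
  by apply/min_idPr; lra.
rewrite (_ : Num.max _ _ = h%:R - u + 1); last by apply/max_idPr; lra.
lra.
Qed.

Lemma sum_weights_ge (w : nat -> R) (lo hi : nat) (u v : R) :
    (lo <= hi)%N -> (forall i, 0 <= w i) -> lo%:R < u -> v <= hi%:R ->
    (forall i, (lo < i <= hi)%N -> u <= i%:R <= v -> w i = 1) ->
  v - u - 1 <= \sum_(lo.+1 <= i < hi.+1) w i.
Proof.
move=> le_lohi w0 lou vhi w1.
(* The cap is [hi + 1] and not [hi]: an end [v] strictly between [h] and [h + 1] brings no new
   integer, so the bound must not grow at that step. *)
suff : Num.min v (hi%:R + 1) - u - 1 <= \sum_(lo.+1 <= i < hi.+1) w i.
  by rewrite (min_idPl _) //; lra.
elim: hi le_lohi w1 {vhi} => [|h IH].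
  rewrite leqn0 => /eqP lo0 _; rewrite big_geq ?lo0 //.
  have : Num.min v (0%:R + 1) <= 0%:R + 1 by rewrite ge_min lexx orbT.
  by move: lou; rewrite lo0; lra.
rewrite leq_eqVlt => /predU1P[<- _|lt_loh w1].
  rewrite big_geq //.
  have : Num.min v (lo%:R + 1) <= lo%:R + 1 by rewrite ge_min lexx orbT.
  by lra.
rewrite big_nat_recr //=.
have {}IH : Num.min v (h%:R + 1) - u - 1 <= \sum_(lo.+1 <= i < h.+1) w i.
  by apply: IH => // i /andP[? ih] ?; apply: w1 => //; apply/andP; split=> //;
     rewrite (leq_trans ih).
have S0 : 0 <= \sum_(lo.+1 <= i < h.+1) w i by apply: sumr_ge0.
have hS : (h.+1%:R : R) = h%:R + 1 by rewrite -natr1.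
have mr : Num.min v (h.+1%:R + 1) <= h%:R + 2.
  by rewrite ge_min hS; apply/orP; right; lra.
have ml : Num.min v (h.+1%:R + 1) <= v by rewrite ge_min lexx.
have := w0 h.+1 => wh0.
have [hu|uh] := ltP (h.+1%:R) u; first by lra.
have [vh|hv] := ltP v (h.+1%:R).
  move: IH; rewrite (min_idPl _); last by lra.
  lra.
have -> : w h.+1 = 1 by apply: w1; rewrite ?uh ?hv //; apply/andP; split.
move: IH; rewrite (min_idPr _); lra.
Qed.

(** Length of [a, b] `&` [p - 1, p]: the point [p] of {1, ..., n} occupies the
    cell [p - 1, p] after scaling by [n]. *)
Definition overlap (a b : R) (p : nat) : R :=
  Num.max 0 (Num.min b p%:R - Num.max a (p%:R - 1)).

Lemma overlap_itv01 a b p : 0 <= overlap a b p <= 1.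
Proof.
rewrite /overlap le_max lexx ge_max ler01 /=.
have : Num.min b p%:R <= p%:R by rewrite ge_min lexx orbT.
have : p%:R - 1 <= Num.max a (p%:R - 1) by rewrite le_max lexx orbT.
lra.
Qed.

Lemma overlap_neq0 a b p : overlap a b p != 0 -> a < p%:R < b + 1.
Proof.
apply: contraNT; rewrite negb_and -!leNgt => h; apply/eqP/max_idPl.
have m1 : Num.min b p%:R <= p%:R by rewrite ge_min lexx orbT.
have m2 : p%:R - 1 <= Num.max a (p%:R - 1) by rewrite le_max lexx orbT.
have m3 : Num.min b p%:R <= b by rewrite ge_min lexx.
have m4 : a <= Num.max a (p%:R - 1) by rewrite le_max lexx.
by case/orP: h; lra.
Qed.

Lemma overlap_eq1 a b p : a + 1 <= p%:R <= b -> overlap a b p = 1.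
Proof.
move=> /andP[ap pb]; rewrite /overlap (min_idPr pb).
by rewrite [Num.max a _](max_idPr _); [rewrite (max_idPr _); lra|lra].
Qed.

(** On the line [y = w + x] (if [up]) or [y = w - x], the condition
    [c <= y <= d] reads [lo_x <= x <= hi_x]. *)
Definition lo_x (up : bool) (c d w : R) := if up then c - w else w - d.
Definition hi_x (up : bool) (c d w : R) := if up then d - w else w - c.

(** The length of the intersection of [a, b], [x0, x1] and [p, q]. With [lo_x] and [hi_x] for [p]
    and [q], it measures the projection of a segment cut by a rectangle. *)
Definition seg_len (a b x0 x1 p q : R) : R :=
  Num.max 0 (Num.min (Num.min b x1) q - Num.max (Num.max a x0) p).

(** Let [M, m] be the interval measured by [seg_len]. A nonzero weight forces [2 i] into
    [M - K - 1, m + K + 1], and [2 i] in [M + K + 1, m - K - 1] forces weight 1; the 1 is the side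
    of a cell. Halving and counting integers gives (m - M) / 2 with error K + 1 + 1. *)
Lemma branch_sum (up : bool) (a b c d x0 x1 w K : R) (f g : nat -> nat)
    (lo hi : nat) :
    (lo <= hi)%N -> 0 <= K ->
    (forall i, (lo < i <= hi)%N -> `|(f i)%:R - 2 * i%:R| <= K) ->
    (forall i, (lo < i <= hi)%N ->
       `|(g i)%:R - (w + (-1) ^+ (~~ up) * (2 * i%:R))| <= K) ->
    `|2 * lo%:R - x0| <= K -> `|2 * hi%:R - x1| <= K ->
  `|\sum_(lo.+1 <= i < hi.+1) overlap a b (f i) * overlap c d (g i)
    - 2^-1 * seg_len a b x0 x1 (lo_x up c d w) (hi_x up c d w)| <= K + 2.
Proof.
move=> le_lohi K0 fE gE loE hiE.
set ww := fun i => overlap a b (f i) * overlap c d (g i).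
have ww01 i : 0 <= ww i <= 1.
  have /andP[? ?] := overlap_itv01 a b (f i).
  have /andP[? ?] := overlap_itv01 c d (g i).
  by rewrite mulr_ge0 //= mulr_ile1.
rewrite /seg_len.
set m := Num.min _ _; set M := Num.max (Num.max _ _) _.
have mE y : (y <= m) = [&& y <= b, y <= x1 & y <= hi_x up c d w].
  by rewrite !le_min andbA.
have ME y : (M <= y) = [&& a <= y, x0 <= y & lo_x up c d w <= y].
  by rewrite !ge_max andbA.
(* Taking [y] to be [m], then [M], yields all the individual bounds on the two ends. *)
have := mE m; rewrite lexx => /esym /and3P[mb mx mq].
have := ME M; rewrite lexx => /esym /and3P[Ma Mx Mp].
have loE' : x0 - K <= 2 * lo%:R <= x0 + K by move: loE; rewrite ler_norml; lra.
have hiE' : x1 - K <= 2 * hi%:R <= x1 + K by move: hiE; rewrite ler_norml; lra.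
have S0 : 0 <= \sum_(lo.+1 <= i < hi.+1) ww i.
  by apply: sumr_ge0 => i _; case/andP: (ww01 i).
have up_ : \sum_(lo.+1 <= i < hi.+1) ww i <=
    Num.max 0 ((m + K + 1) / 2 - (M - K - 1) / 2 + 1).
  apply: sum_weights_le => // i loi.
  rewrite mulf_eq0 negb_or => /andP[/overlap_neq0 hf /overlap_neq0 hg].
  have := fE i loi; have := gE i loi; rewrite !ler_norml => hgi hfi.
  have lo_i : (lo%:R <= i%:R :> R) by rewrite ler_nat; case/andP: loi => /ltnW.
  have hi_i : (i%:R <= hi%:R :> R) by rewrite ler_nat; case/andP: loi.
  have : M <= 2 * i%:R + K + 1.
    rewrite ME /lo_x; move: hgi; case: (up) => /=;
    rewrite ?expr0 ?expr1; lra.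
  have : 2 * i%:R - K - 1 <= m.
    rewrite mE /hi_x; move: hgi; case: (up) => /=;
    rewrite ?expr0 ?expr1; lra.
  lra.
have lo_ : (m - K - 1) / 2 - (M + K + 1) / 2 - 1 <= \sum_(lo.+1 <= i < hi.+1) ww i.
  apply: sum_weights_ge => //; [by move=> i; case/andP: (ww01 i)|lra|lra|].
  move=> i loi hi_.
  have := fE i loi; have := gE i loi; rewrite !ler_norml => hgi hfi.
  rewrite /ww !overlap_eq1 ?mulr1 //; last by lra.
  move: hgi Mp mq; rewrite /lo_x /hi_x.
  by case: (up) => /=; rewrite ?expr0 ?expr1; lra.
rewrite ler_norml.
have [h|h] := leP 0 (m - M).
  move: up_; rewrite [X in _ <= X](max_idPr _); lra.
(* Here [m < M], so [seg_len] vanishes and only the error term is left. *)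
have : Num.max 0 ((m + K + 1) / 2 - (M - K - 1) / 2 + 1) <= K + 2.
  by rewrite ge_max; lra.
lra.
Qed.

End Counting.

Arguments lo_x : simpl never.
Arguments hi_x : simpl never.

(** * Closed formulas for both permutons on a rectangle *)

Section Measures.
Variable R : realType.

Lemma lebesgue_measure_setI_itv (a b a' b' : R) :
  lebesgue_measure (`[a, b]%classic `&` `[a', b']%classic) =
  (Num.max 0 (Num.min b b' - Num.max a a'))%:E.
Proof.
have -> : `[a, b]%classic `&` `[a', b']%classic =
    `[Num.max a a', Num.min b b']%classic.
  by apply/seteqP; split=> x /=; rewrite !in_itv /= ge_max le_min; lra.
rewrite lebesgue_measure_itv /= lte_fin; case: ltP => h.
  by have dx := ltW h; rewrite -subr_ge0 in dx; rewrite (max_idPr dx) EFinB.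
by have dx := h; rewrite -subr_le0 in dx; rewrite (max_idPl dx).
Qed.

Lemma mu_permE (n : nat) (s : 'S_n) (a b c d : R) :
  mu_perm s (`[a, b] `*` `[c, d]) =
  (n%:R^-1 * \sum_(i < n) overlap (n%:R * a) (n%:R * b) i.+1 *
     overlap (n%:R * c) (n%:R * d) (s i).+1)%:E.
Proof.
rewrite /mu_perm mulr_sumr -sumEFin; apply: eq_bigr => i _.
have n0 : 0 < (n%:R : R) by rewrite ltr0n (leq_trans _ (ltn_ord i)).
rewrite /perm_cell /lebesgue2 -setXI.
have -> := product_measure1E (@lebesgue_measure R) (@lebesgue_measure R)
  (measurableI _ _ (measurable_itv _) (measurable_itv _))
  (measurableI _ _ (measurable_itv _) (measurable_itv _)).
rewrite -[X in (_ * X)%E]/(lebesgue_measure _ * lebesgue_measure _)%E.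
rewrite !lebesgue_measure_setI_itv -!EFinM; congr EFin.
(* Each side contributes a factor [n^-1] after scaling; with the density [n], a single [n^-1]
   remains. *)
have sc (x y : R) (k : nat) :
    Num.max 0 (Num.min y (k.+1%:R / n%:R) - Num.max x (k%:R / n%:R)) =
    n%:R^-1 * overlap (n%:R * x) (n%:R * y) k.+1.
  have n0' := ltW n0; rewrite /overlap -natr1 addrK.
  rewrite -[LHS](mulKf (lt0r_neq0 n0)); congr (_ * _).
  rewrite maxr_pMr // mulr0 mulrBr minr_pMr // maxr_pMr //.
  by rewrite ![n%:R * (_ / n%:R)]mulrC !divfK ?lt0r_neq0.
rewrite !sc; field.
by rewrite lt0r_neq0.
Qed.

(** On such a segment the abscissa determines the ordinate, so each side of the rectangle becomes a
    bound on [x] and the projection is an interval. *)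
Lemma lebesgue_proj_segment (up : bool) (a b c d x0 x1 w : R) : x0 < x1 ->
  lebesgue_measure (fst @` ((`[a, b] `*` `[c, d]) `&`
    segment (x0, w + (-1) ^+ (~~ up) * x0) (x1, w + (-1) ^+ (~~ up) * x1))) =
  (seg_len a b x0 x1 (lo_x up c d w) (hi_x up c d w))%:E.
Proof.
move=> lt_x.
set J := _ @` _.
have -> : J = `[Num.max a x0, Num.min b x1]%classic `&`
    `[lo_x up c d w, hi_x up c d w]%classic.
  apply/seteqP; split=> [_ [[x y] [[/= ab cd] [t t01 [xE yE]]] <-]|x] /=.
    move: ab cd t01; rewrite /= -xE -yE !in_itv /= ge_max le_min /lo_x /hi_x.
    move=> ab cd t01.
    have [y1 y2] : x0 <= (1 - t) * x0 + t * x1 /\ (1 - t) * x0 + t * x1 <= x1.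
      by split; nra.
    by move: cd; case: (up); rewrite /= ?expr0 ?expr1; lra.
  rewrite !in_itv /= ge_max le_min /lo_x /hi_x => -[/andP[/andP[? ?] /andP[? ?]] pq].
  have dx : 0 < x1 - x0 by rewrite subr_gt0.
  exists (x, w + (-1) ^+ (~~ up) * x) => //; split.
    split=> /=; rewrite in_itv /=; first lra.
    by move: pq; case: (up); rewrite /= ?expr0 ?expr1; lra.
  (* The parameter of the point above [x]; it is defined because [x0 < x1]. *)
  exists ((x - x0) / (x1 - x0)).
    rewrite /= in_itv /=; apply/andP; split; first by rewrite divr_ge0; lra.
    rewrite ler_pdivrMr //; lra.
  by congr pair => /=; field; rewrite lt0r_neq0.
exact: lebesgue_measure_setI_itv.
Qed.

Lemma seg_lenM (k a b x0 x1 p q : R) : 0 <= k ->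
  k * seg_len a b x0 x1 p q =
  seg_len (k * a) (k * b) (k * x0) (k * x1) (k * p) (k * q).
Proof.
move=> k0; rewrite /seg_len.
by rewrite maxr_pMr // mulr0 mulrBr !minr_pMr // !maxr_pMr.
Qed.

End Measures.

(** The four segments lie on y = z - x, y = z + x, y = -z + x and y = 2 - z - x. For 0 < z < 1 none
    of them degenerates. *)
Lemma mu_zE (R : realType) (z a b c d : R) : 0 < z < 1 ->
  mu_z z (`[a, b] `*` `[c, d]) =
  (2^-1 * seg_len a b 0 z (lo_x false c d z) (hi_x false c d z) +
   2^-1 * seg_len a b 0 (1 - z) (lo_x true c d z) (hi_x true c d z) +
   2^-1 * seg_len a b z 1 (lo_x true c d (- z)) (hi_x true c d (- z)) +
   2^-1 * seg_len a b (1 - z) 1 (lo_x false c d (2 - z)) (hi_x false c d (2 - z)))%:E.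
Proof.
move=> /andP[z0 z1]; rewrite !EFinD !EFinM.
rewrite -!lebesgue_proj_segment ?subr_gt0 //; last by lra.
rewrite /mu_z /= !expr1 !expr0.
by congr (_ * lebesgue_measure (fst @` (_ `&` segment (_, _) (_, _))) +
  _ * lebesgue_measure (fst @` (_ `&` segment (_, _) (_, _))) +
  _ * lebesgue_measure (fst @` (_ `&` segment (_, _) (_, _))) +
  _ * lebesgue_measure (fst @` (_ `&` segment (_, _) (_, _))))%E; ring.
Qed.

(** * Global consequences of the Petrov conditions *)

Section Petrov.
Variables (R : realType) (T : eqType) (n : nat) (X : n.-tuple T) (A : T).
Hypotheses (n_large : 6 <= (n%:R : R) `^ (3 / 10)) (XA : petrov_label R X A).
Let e := (n%:R : R) `^ (6 / 10).

Lemma large_ge1 : 1 <= (n%:R : R).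
Proof.
rewrite ler1n lt0n; apply/eqP => n0; move: n_large.
by rewrite n0 powR0 //; lra.
Qed.

Lemma powR_6 : e = (n%:R : R) `^ (3 / 10) * (n%:R : R) `^ (3 / 10).
Proof.
rewrite -powRD; first by congr (_ `^ _); field.
by apply/implyP => _; rewrite gt_eqF // (lt_le_trans ltr01 large_ge1).
Qed.

Lemma powR_3_lt_6 : (n%:R : R) `^ (3 / 10) < e.
Proof. by have h := n_large; rewrite powR_6 ltr_pMr; lra. Qed.

Lemma powR_4_le_6 : (n%:R : R) `^ (4 / 10) <= e.
Proof. by apply: ler_powR; [exact: large_ge1|lra]. Qed.

Lemma powR_nat_le i : (i <= n)%N -> (i%:R : R) `^ (6 / 10) <= e.
Proof. by move=> le_in; rewrite ge0_ler_powR ?nnegrE ?ler_nat //; lra. Qed.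

(** Compare [i] with 0: the first condition applies if [i < e], and the second otherwise, because
    [e] exceeds n^0.3. Both error bounds are at most [e]. *)
Lemma petrov_ct i : (i <= n)%N -> `|(ct X A i)%:R - 2^-1 * i%:R| <= e.
Proof.
move=> le_in; have [p1 p2 _ _] := XA.
have ct0 : ct X A 0 = 0%N by rewrite /ct take0.
have := p1 i 0%N le_in isT; have := p2 i 0%N le_in isT.
rewrite ct0 !subr0 [`|i%:R|]ger0_norm // => h2 h1.
have e0 : 0 <= (i%:R : R) `^ (6 / 10) by exact: powR_ge0.
have := powR_nat_le le_in; have := powR_4_le_6; have := powR_3_lt_6.
have [/h1|ei] := ltP (i%:R : R) e; first by lra.
by have /h2 : (n%:R : R) `^ (3 / 10) < i%:R := lt_le_trans powR_3_lt_6 ei; lra.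
Qed.

(** The same comparison with 0, by the third and fourth conditions; the factor 2 is that of the
    fourth. *)
Lemma petrov_pos i : (i <= ct X A n)%N -> `|(pos X A i)%:R - 2 * i%:R| <= 2 * e.
Proof.
move=> le_ic; have [_ _ p1 p2] := XA.
have le_in := leq_trans le_ic (ct_max X A).
have := p1 i 0%N le_ic isT; have := p2 i 0%N le_ic isT.
rewrite [pos X A 0]/pos /= !subr0 [`|i%:R|]ger0_norm // => h2 h1.
have e0 : 0 <= (n%:R : R) `^ (4 / 10) by exact: powR_ge0.
have := powR_nat_le le_in; have := powR_4_le_6; have := powR_3_lt_6.
have [/h1|ei] := ltP (i%:R : R) e; first by lra.
by have /h2 : (n%:R : R) `^ (3 / 10) < i%:R := lt_le_trans powR_3_lt_6 ei; lra.
Qed.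

End Petrov.

Lemma inv_oneE (n : nat) (s : 'S_n) (i : 'I_n) :
  s i = 0%N :> nat -> inv_one s = i.+1.
Proof.
case: n s i => [|m] s i; first by case: i.
move=> s_i /=; have -> : ord0 = s i by apply: val_inj; rewrite /= s_i.
by rewrite permK.
Qed.

(** * The diagram of [rho] as a list of points *)

Section LambdaSeq.
Variables (n : nat) (X : n.-tuple ud) (Y : n.-tuple lr) (z0 : nat).
Let d0 := ct X Down z0.
Let k := (ct Y Left n - d0)%N.
Hypotheses (le_d0 : (d0 <= ct Y Left n)%N) (le_k : (k <= ct X Up n)%N).

Definition points (f g : nat -> nat) lo hi :=
  [seq (f i, g i) | i <- index_iota lo.+1 hi.+1].

Definition Lambda_seq :=
  (points (pos X Down) (fun i => pos Y Left (d0 + 1 - i)%N) 0 d0 ++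
   points (pos X Up) (fun i => pos Y Left (d0 + i)%N) 0 k) ++
  (points (pos X Down) (fun i => pos Y Right (i - d0)%N) d0 (ct X Down n) ++
   points (pos X Up) (fun i => pos Y Right (n - d0 + 1 - i)%N) k (ct X Up n)).

Lemma set_points f g lo hi :
  [set (f i, g i) | i in [set i | (lo < i <= hi)%N]] = [set` points f g lo hi].
Proof.
apply/seteqP; split=> [_ [i /= loi <-]|p /= /mapP[i loi ->]].
  by apply/mapP; exists i => //; rewrite mem_index_iota.
by exists i => //=; rewrite mem_index_iota in loi.
Qed.

(** As [z2] is the position of the [k]-th [Up] and [k] does not exceed the number of [Up]s, [ct_pos]
    turns the bound [ctU z2] into [k]. *)
Lemma Lambda_seqE : Lambda (X, Y, z0) = [set` Lambda_seq].
Proof.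
rewrite /Lambda /Lambda_seq -/d0 -/k ct_pos // !addn1 !set_points.
apply/seteqP; split=> p /=; rewrite !mem_cat.
  by case=> [[[]|]|] ->; rewrite ?orbT.
by case/orP=> /orP[] ->; [left; left; left|left; left; right|left; right|right].
Qed.

Lemma ctUD : (ct X Up n + ct X Down n)%N = n.
Proof. by apply: ctD => //; case. Qed.

Lemma ctLR : (ct Y Left n + ct Y Right n)%N = n.
Proof. by apply: ctD => //; case. Qed.

Lemma unzip1_points f g lo hi :
  unzip1 (points f g lo hi) = [seq f i | i <- index_iota lo.+1 hi.+1].
Proof. by rewrite /unzip1 /points -map_comp. Qed.

Lemma unzip2_points f g lo hi :
  unzip2 (points f g lo hi) = [seq g i | i <- index_iota lo.+1 hi.+1].
Proof. by rewrite /unzip2 /points -map_comp. Qed.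

Lemma index_iota_cat a b c : (a <= b <= c)%N ->
  index_iota a b ++ index_iota b c = index_iota a c.
Proof.
move=> /andP[ab bc]; rewrite /index_iota -{2}(subnKC ab) -iotaD; congr iota; lia.
Qed.

(** An injection between integer intervals of equal size is onto; this covers both the shifts and
    the reversals of indices in [Lambda]. *)
Lemma perm_shift (h : nat -> nat) a b a' b' :
  (b' - a')%N = (b - a)%N ->
  (forall i, (a <= i < b)%N -> (a' <= h i < b')%N) ->
  (forall i j, (a <= i < b)%N -> (a <= j < b)%N -> h i = h j -> i = j) ->
  perm_eq [seq h i | i <- index_iota a b] (index_iota a' b').
Proof.
move=> eqs hin hinj.
have u : uniq [seq h i | i <- index_iota a b].
  rewrite map_inj_in_uniq ?iota_uniq // => i j.
  by rewrite !mem_index_iota; exact: hinj.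
apply: uniq_perm => //; first exact: iota_uniq.
have sub : {subset [seq h i | i <- index_iota a b] <= index_iota a' b'}.
  by move=> _ /mapP[i + ->]; rewrite !mem_index_iota; exact: hin.
by have [|_] := uniq_min_size u sub; first by rewrite size_map !size_iota eqs.
Qed.

Lemma perm_unzip1 : perm_eq (unzip1 Lambda_seq) (iota 1 n).
Proof.
rewrite /unzip1 /Lambda_seq !map_cat -!/(unzip1 _) !unzip1_points.
(* Swapping the two middle families puts both [Down] ranges together, and both [Up] ranges. *)
apply: perm_trans (permEl (perm_catACA _ _ _ _)) _.
rewrite -!map_cat !index_iota_cat ?ltnS ?ct_leq // /index_iota !subn1 /=.
by rewrite !map_pos_iota; apply: perm_positions => //; case.
Qed.

(** The first family runs backwards through the [Left] indices up to [d0] and the second forwards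
    through the others. The third runs forwards through the [Right] indices up to [ct X Down n - d0]
    and the fourth backwards through the rest. *)
Lemma perm_unzip2 : perm_eq (unzip2 Lambda_seq) (iota 1 n).
Proof.
have UD := ctUD; have LR := ctLR; have dD : (d0 <= ct X Down n)%N := ct_leq _ _ _.
rewrite /unzip2 /Lambda_seq !map_cat -!/(unzip2 _) !unzip2_points.
have le_k' := le_k; have kE : k = (ct Y Left n - d0)%N by [].
have /(perm_trans _) : perm_eq (positions Y Left ++ positions Y Right) (iota 1 n).
  by apply: perm_positions => //; case.
apply.
rewrite -!map_pos_iota; apply: perm_cat.
  have -> : iota 1 (ct Y Left n) =
      index_iota 1 d0.+1 ++ index_iota d0.+1 (ct Y Left n).+1.
    by rewrite index_iota_cat ?ltnS // /index_iota subn1.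
  rewrite map_cat; apply: perm_cat.
    rewrite (map_comp (pos Y Left) (fun i => d0 + 1 - i)%N).
    by apply: perm_map; apply: perm_shift => *; lia.
  rewrite (map_comp (pos Y Left) (fun i => d0 + i)%N).
  by apply: perm_map; apply: perm_shift => *; lia.
have -> : iota 1 (ct Y Right n) = index_iota 1 (ct X Down n - d0).+1 ++
    index_iota (ct X Down n - d0).+1 (ct Y Right n).+1.
  rewrite index_iota_cat; first by rewrite /index_iota subn1.
  by lia.
rewrite map_cat; apply: perm_cat.
  rewrite (map_comp (pos Y Right) (fun i => i - d0)%N).
  by apply: perm_map; apply: perm_shift => *; lia.
rewrite (map_comp (pos Y Right) (fun i => n - d0 + 1 - i)%N).
by apply: perm_map; apply: perm_shift => *; lia.
Qed.

Lemma rho_diagram : diagram (rho (X, Y, z0)) = [set` Lambda_seq].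
Proof.
have [s sE] := diagram_exists perm_unzip1 perm_unzip2.
rewrite -Lambda_seqE in sE *.
exact: (@xgetPex _ 1%g [set s : 'S_n | diagram s = Lambda (X, Y, z0)]
  (ex_intro _ s sE)).
Qed.

Lemma uniq_Lambda_seq : uniq Lambda_seq.
Proof.
by apply: (@map_uniq _ _ fst); rewrite (perm_uniq perm_unzip1) iota_uniq.
Qed.

Lemma inv_one_rho : (0 < z0 <= n)%N -> nth Down X z0.-1 = Down ->
  nth Left Y 0 = Left -> inv_one (rho (X, Y, z0)) = z0.
Proof.
move=> /andP[z0_gt0 z0_le] Xz0 Y0.
have posz : pos X Down d0 = z0 by rewrite pos_ct ?z0_gt0.
have d0_gt0 : (0 < d0)%N.
  by rewrite lt0n; apply/eqP => d0E; move: posz z0_gt0; rewrite d0E => <-.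
have : diagram (rho (X, Y, z0)) (z0, 1%N).
  rewrite rho_diagram /= !mem_cat; apply/orP; left; apply/orP; left.
  (* The last point of the first family: its ordinate is the position of the first [Left], which is
     1 because [Y] starts with [Left]. *)
  apply/mapP; exists d0; first by rewrite mem_index_iota d0_gt0 /=.
  by rewrite posz addKn pos_first // (leq_trans z0_gt0).
by case=> i _ [<- /inv_oneE].
Qed.

End LambdaSeq.

(** * The estimate for one triple of [Omega] *)

Section Estimate.
Variables (R : realType) (n : nat) (X : n.-tuple ud) (Y : n.-tuple lr) (z0 : nat).
Hypotheses (n_large : 6 <= (n%:R : R) `^ (3 / 10)).
Hypothesis w_Omega : Omega R n (X, Y, z0).
Let e := (n%:R : R) `^ (6 / 10).
Let d0 := ct X Down z0.
Let k := (ct Y Left n - d0)%N.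

Lemma powR_6_ge1 : 1 <= e.
Proof. by rewrite -(powRr0 (n%:R : R)); apply: ler_powR; [exact: large_ge1|lra]. Qed.

Lemma powR_9_ge : 6 * e <= (n%:R : R) `^ (9 / 10).
Proof.
have -> : 9 / 10 = 3 / 10 + 6 / 10 :> R by field.
rewrite powRD; first by rewrite ler_wpM2r // powR_ge0.
by apply/implyP => _; rewrite gt_eqF // (lt_le_trans ltr01 (large_ge1 n_large)).
Qed.

(** The bound on [k] explains the constant 6 in [n_large]: [k] is at most (n - z0) / 2 + 2 e and
    [ct X Up n] at least n / 2 - e, so z0 >= 6 e suffices. *)
Lemma Omega_ct_bounds :
  [/\ (z0 < n)%N, (d0 <= ct Y Left n)%N, (k <= ct X Up n)%N,
      `|2 * d0%:R - z0%:R| <= 2 * e & `|2 * k%:R - (n%:R - z0%:R)| <= 4 * e].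
Proof.
have [/andP[z0_gt0 z0_le] _ _ [pX pY] /andP[z_ge z_le]] := w_Omega.
have e1 := powR_6_ge1; have e9 := powR_9_ge.
have := petrov_ct n_large (pX Down) z0_le.
have := petrov_ct n_large (pY Left) (leqnn n).
have := petrov_ct n_large (pX Up) (leqnn n).
rewrite -/e -/d0 !ler_norml => bU bL bd.
have le_d0 : (d0 <= ct Y Left n)%N by rewrite -(ler_nat R); lra.
have kE : k%:R = (ct Y Left n)%:R - d0%:R :> R by rewrite natrB.
split=> //; try lra.
- by rewrite -(ltr_nat R); lra.
- by rewrite -(ler_nat R) kE; lra.
Qed.

Lemma lo_xM (up : bool) (t c d w : R) :
  t * lo_x up c d w = lo_x up (t * c) (t * d) (t * w).
Proof. by rewrite /lo_x; case: up; rewrite mulrBr. Qed.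

Lemma hi_xM (up : bool) (t c d w : R) :
  t * hi_x up c d w = hi_x up (t * c) (t * d) (t * w).
Proof. by rewrite /hi_x; case: up; rewrite mulrBr. Qed.

Lemma points_sum (up : bool) (a b c d x0 x1 w : R) (f g : nat -> nat) (lo hi : nat) :
    (lo <= hi)%N ->
    (forall i, (lo < i <= hi)%N -> `|(f i)%:R - 2 * i%:R| <= 6 * e) ->
    (forall i, (lo < i <= hi)%N ->
       `|(g i)%:R - (n%:R * w + (-1) ^+ (~~ up) * (2 * i%:R))| <= 6 * e) ->
    `|2 * lo%:R - n%:R * x0| <= 6 * e -> `|2 * hi%:R - n%:R * x1| <= 6 * e ->
  `|n%:R^-1 * \sum_(p <- points f g lo hi)
      overlap (n%:R * a) (n%:R * b) p.1 * overlap (n%:R * c) (n%:R * d) p.2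
    - 2^-1 * seg_len a b x0 x1 (lo_x up c d w) (hi_x up c d w)| <= 8 * e / n%:R.
Proof.
move=> le_lohi fE gE loE hiE; have e1 := powR_6_ge1.
have n_gt0 : 0 < n%:R :> R := lt_le_trans ltr01 (large_ge1 n_large).
rewrite /points big_map ler_pdivlMr // -[X in _ * X <= _](gtr0_norm n_gt0) -normrM.
rewrite [(_ - _) * _]mulrC mulrBr mulVKf ?gt_eqF // mulrCA.
rewrite (seg_lenM _ _ _ _ _ _ (ltW n_gt0)) lo_xM hi_xM.
have e0 : 0 <= 6 * e by lra.
(* With K = 6 e the error K + 2 is at most 8 e, since [e] is at least 1. *)
by apply: le_trans (branch_sum _ _ _ _ le_lohi e0 fE gE loE hiE) _; lra.
Qed.

Lemma ler_dist4 (t1 t2 t3 t4 b1 b2 b3 b4 r : R) :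
    `|t1 - b1| <= r -> `|t2 - b2| <= r -> `|t3 - b3| <= r -> `|t4 - b4| <= r ->
  `|t1 + t2 + (t3 + t4) - (b1 + b2 + b3 + b4)| <= 4 * r.
Proof. rewrite !ler_norml; lra. Qed.

Lemma d_square_rho :
  (d_square (mu_perm (R := R) (rho (X, Y, z0)))
     (mu_z ((inv_one (rho (X, Y, z0)))%:R / n%:R)) <= (32 * e / n%:R)%:E)%E.
Proof.
have [z0_range [_ _ Xz0] [Y0 _] [pX pY] _] := w_Omega.
have /andP[z0_gt0 z0_le] := z0_range.
have [z0_lt le_d0 le_k d0E kE] := Omega_ct_bounds.
have n_gt0 : 0 < n%:R :> R := lt_le_trans ltr01 (large_ge1 n_large).
have n_neq0 : n%:R != 0 :> R by rewrite gt_eqF.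
have e1 := powR_6_ge1.
rewrite inv_one_rho //; first last.
(* [Omega] reads the letters with defaults that [inv_one_rho] does not use; the indices are in
   range, so the values agree. *)
- by rewrite -Y0; apply: set_nth_default; rewrite size_tuple (leq_trans z0_gt0).
- by rewrite -[RHS]Xz0; apply: set_nth_default; rewrite size_tuple prednK.
apply: ge_ereal_sup => _ [_ [a [b [c [d [_ _ _ _ ->]]]]] <-].
have z01 : 0 < (z0%:R / n%:R : R) < 1.
  apply/andP; split; first by rewrite divr_gt0 // ltr0n.
  by rewrite ltr_pdivrMr // mul1r ltr_nat.
rewrite mu_permE mu_zE // -EFinB abse_EFin lee_fin.
rewrite (big_diagram (fun p q => overlap (n%:R * a) (n%:R * b) p *
  overlap (n%:R * c) (n%:R * d) q) (uniq_Lambda_seq le_d0 le_k)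
  (rho_diagram le_d0 le_k)).
rewrite !big_cat /= !mulrDr -/d0 -/k.
have nz : n%:R * (z0%:R / n%:R) = z0%:R :> R by rewrite mulrC divfK.
have UD_nat := ctUD X; have LR_nat := ctLR Y.
have dD : (d0 <= ct X Down n)%N := ct_leq _ _ _.
have posX A i (le_i : (i <= ct X A n)%N) := petrov_pos n_large (pX A) le_i.
have posY A i (le_i : (i <= ct Y A n)%N) := petrov_pos n_large (pY A) le_i.
have nDE := petrov_ct n_large (pX Down) (leqnn n).
have nUE := petrov_ct n_large (pX Up) (leqnn n).
rewrite -/e in nDE nUE.
have posX6 A i : (i <= ct X A n)%N -> `|(pos X A i)%:R - 2 * i%:R| <= 6 * e.
  by move=> /posX; rewrite -/e !ler_norml; lra.
rewrite (_ : 32 * e / n%:R = 4 * (8 * e / n%:R)); last by field.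
rewrite ler_norml in nDE; rewrite ler_norml in nUE.
rewrite ler_norml in d0E; rewrite ler_norml in kE.
(* Each family leaves four goals: abscissas, ordinates, lower end, upper end. The largest error is
   in the ordinates of the first and fourth families: 2 e from [pos], 2 e from [d0], and 2 from the
   shift by one in the index, hence at most 6 e. *)
apply: ler_dist4; apply: points_sum;
  rewrite //= ?mulr0 ?mulr1 ?mulrBr ?mulr1 ?mulrN ?nz.
- move=> i /andP[_ le_i]; exact: posX6 (leq_trans le_i dD).
- move=> i /andP[i_gt0 le_i].
  have /posY : (d0 + 1 - i <= ct Y Left n)%N by move: i_gt0 le_d0; clear; lia.
  rewrite -/e natrB ?natrD; last by rewrite addn1 ltnW.
  by rewrite expr1 !ler_norml; lra.
- by rewrite ler_norml; lra.
- by rewrite ler_norml; lra.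
- move=> i /andP[_ le_i]; exact: posX6 (leq_trans le_i le_k).
- move=> i /andP[i_gt0 le_i].
  have /posY : (d0 + i <= ct Y Left n)%N by move: le_i le_d0; rewrite /k; clear; lia.
  by rewrite -/e natrD expr0 !ler_norml; lra.
- by rewrite ler_norml; lra.
- by rewrite ler_norml; lra.
- by move=> i /andP[_ le_i]; exact: posX6.
- move=> i /andP[i_gt0 le_i].
  (* Both words have length [n], so [k <= ct X Up n] amounts to
     [ct X Down n - d0 <= ct Y Right n]. *)
  have /posY : (i - d0 <= ct Y Right n)%N.
    by move: le_i le_k UD_nat LR_nat le_d0; rewrite /k; clear; lia.
  rewrite -/e natrB; last exact: ltnW.
  by rewrite expr0 !ler_norml; lra.
- by rewrite ler_norml; lra.
- by rewrite ler_norml; lra.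
- by move=> i /andP[_ le_i]; exact: posX6.
- move=> i /andP[i_gt0 le_i].
  have /posY : (n - d0 + 1 - i <= ct Y Right n)%N.
    by move: i_gt0 LR_nat le_d0; rewrite /k; clear; lia.
  have d0_n : (d0 <= n)%N := leq_trans dD (ct_max X Down).
  have i_n : (i <= n - d0 + 1)%N by move: le_i UD_nat dD; clear; lia.
  rewrite -/e natrB // natrD natrB //.
  by rewrite expr1 !ler_norml; lra.
- by rewrite ler_norml; lra.
- by rewrite ler_norml; lra.
Qed.

End Estimate.

(** * Uniformity over [Omega] for large [n] *)

Theorem lemma4p3 (R : realType) :
  \forall n \near \oo,
    (ereal_sup [set d_square (mu_perm (R := R) s) (mu_z ((inv_one s)%:R / n%:R))
               | s in [set rho w | w in Omega R n]]
     < (400 * (n%:R : R) `^ (- (4 / 10)))%:E)%E.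
Proof.
near=> n.
(* This threshold is what makes n^0.3 at least 6. *)
have n_ge : 6 `^ (10 / 3) <= n%:R :> R by near: n; exact: nbhs_infty_ger.
have n_large : 6 <= (n%:R : R) `^ (3 / 10).
  have -> : 6 = (6 `^ (10 / 3)) `^ (3 / 10) :> R.
    by rewrite -powRrM (_ : _ * _ = 1) ?powRr1 //; field.
  by rewrite ge0_ler_powR ?nnegrE ?powR_ge0 //; lra.
have n_gt0 : 0 < n%:R :> R := lt_le_trans ltr01 (large_ge1 n_large).
have p_gt0 := powR_gt0 (- (4 / 10)) n_gt0.
(* A supremum only inherits a weak bound; strictness comes from 32 < 400. *)
apply: (@le_lt_trans _ _ (32 * (n%:R : R) `^ (- (4 / 10)))%:E); last first.
  by rewrite lte_fin; lra.
apply: ge_ereal_sup => _ [_ [[[X Y] z0] w <-] <-].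
suff -> : 32 * (n%:R : R) `^ (- (4 / 10)) = 32 * (n%:R : R) `^ (6 / 10) / n%:R.
  exact: d_square_rho.
have -> : - (4 / 10) = 6 / 10 - 1 :> R by field.
rewrite powRB; last by rewrite (gt_eqF n_gt0) implybT.
by rewrite (powRr1 (ltW n_gt0)) mulrA.
Unshelve. all: by end_near.
Qed.
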